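(* The parameter space of eigenschemes of symmetric tensors in $\mathrm{Sym}^3\mathbb{C}^4$, i.e. the locus $\{[H_f] : f\in\mathbb{C}[x_0,\dots,x_3]_3\}\subset \mathrm{Gr}(3,\mathbb{P}^{14})$, is an open subvariety of a linear subspace of $\mathrm{Gr}(3,\mathbb{P}^{14})$ (that is, of a subvariety of $\mathrm{Gr}(3,\mathbb{P}^{14})$ cut out by linear relations in the Plücker coordinates).
   Context: A symmetric tensor in $\mathrm{Sym}^3\mathbb{C}^4$ is identified with a homogeneous cubic polynomial $f\in\mathbb{C}[x_0,\dots,x_3]_3$, and it is viewed as the partially symmetric tensor $(q_0,\dots,q_3)$ with $q_i=\frac{\partial f}{\partial x_i}$. Its eigenscheme $E(f)\subset\mathbb{P}^3$ is the common vanishing scheme of the $2\times2$ minors of the matrix with rows $(x_0,\dots,x_3)$ and $(q_0,\dots,q_3)$. To $f$ one associates the projective $3$-plane $H_f:=\mathrm{Span}_{\mathbb{C}}\left(\frac{\partial f}{\partial x_0}-\lambda x_0,\dots,\frac{\partial f}{\partial x_3}-\lambda x_3\right)$ in $\mathbb{P}^{14}=\mathbb{P}(\mathbb{C}[x_0,\dots,x_3,\lambda]_2)$. $\mathrm{Gr}(3,\mathbb{P}^{14})$ is the Grassmannian of projective $3$-planes in $\mathbb{P}^{14}$, and $[H_f]$ is the corresponding point. Plücker coordinates are taken with respect to the monomial basis of $\mathbb{C}[x_0,\dots,x_3,\lambda]_2$. *)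

(* Defs.v *)
From HB Require Import structures.
From mathcomp Require Import all_boot all_order all_algebra.
From mathcomp Require Import mpoly complex.
From mathcomp Require Import boolp classical_sets reals.

Set Implicit Arguments.
Unset Strict Implicit.
Unset Printing Implicit Defensive.

Import GRing.Theory.
Local Open Scope ring_scope.
Local Open Scope classical_set_scope.

(* K[x_0, ..., x_3, lambda]_2; the first four variables are the x_i and the
   last one, 'X_ord_max, is lambda. *)
Notation quadric K := (dhomog 5 K 2).

(** * The Grassmannian Gr(3, P^14) and its Plücker coordinates *)

(* Projective 3-planes of P(V) are 4-dimensional linear subspaces of V. *)
Definition Gr (K : fieldType) := {W : {vspace quadric K} | \dim W == 4%N}.

(* The 15 monomials of degree 2 in x_0, ..., x_3, lambda. *)
Definition qmon : finType := {m : 'X_{1..5 < 3} | mdeg m == 2%N}.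

Definition pl_index : finType := {I : {set qmon} | #|I| == 4%N}.

Definition pl_mon (I : pl_index) (j : 'I_4) : 'X_{1..5} :=
  bmnm (val (enum_val (cast_ord (esym (eqP (valP I))) j))).

Definition pl_minor (K : fieldType) (b : 'I_4 -> quadric K) (I : pl_index) : K :=
  \det (\matrix_(i < 4, j < 4) (mpoly_of_dhomog (b i))@_(pl_mon I j)).

(* Computed from the library's basis of W. Another basis multiplies all the
   coordinates by one nonzero scalar, so the vanishing of a homogeneous
   polynomial at these coordinates depends on W only. *)
Definition pl_coord (K : fieldType) (W : Gr K) (I : pl_index) : K :=
  pl_minor (fun i => (vbasis (val W))`_i) I.

Notation pl_poly K := {mpoly K[#|pl_index|]}.

Definition pl_eval (K : fieldType) (F : pl_poly K) (W : Gr K) : K :=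
  F.@[fun k => pl_coord W (enum_val k)].

Definition pl_zeros (K : fieldType) (s : seq (pl_poly K)) : set (Gr K) :=
  [set W | forall F, F \in s -> pl_eval F W = 0].

Definition linear_section (K : fieldType) (Z : set (Gr K)) : Prop :=
  exists2 s : seq (pl_poly K),
    forall F, F \in s -> F \is 1.-homog for mdeg & Z = pl_zeros s.

Definition zariski_closed (K : fieldType) (Z : set (Gr K)) : Prop :=
  exists2 s : seq (pl_poly K),
    forall F, F \in s -> exists d : nat, F \is d.-homog for mdeg
    & Z = pl_zeros s.

Definition zariski_open_in (K : fieldType) (Z A : set (Gr K)) : Prop :=
  exists2 Y : set (Gr K), zariski_closed Y & A = Z `\` Y.

(** * The 3-plane attached to a cubic form *)

Section EigenPlane.
Variable K : fieldType.
Implicit Types (f : dhomog 4 K 3) (i : 'I_4).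

Definition eigen_gen_poly f i : {mpoly K[5]} :=
  mwiden (mpoly_of_dhomog f)^`M(i) - 'X_ord_max * mwiden 'X_i.

Lemma eigen_gen_homog f i : eigen_gen_poly f i \is 2.-homog for mdeg.
Proof.
have wX m : mdeg m = 2%N -> (mwiden 'X_[K, m]) \is 2.-homog for mdeg.
  move=> dm; rewrite mwidenX dhomogX /= -[X in _ == X]dm; apply/eqP.
  rewrite !mdegE big_ord_recr /= mnmwiden_ordmax addn0.
  by apply: eq_bigr => j _; rewrite mnmwiden_widen.
rewrite /eigen_gen_poly rpredB //; last first.
  by rewrite mwidenX mnmwiden1 -mpolyXD dhomogX /= mdegD !mdeg1.
rewrite /mderiv !raddf_sum /= big_seq rpred_sum // => m mf.
have dm : mdeg m = 3%N by case: f mf => p /= /dhomogP; apply.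
rewrite mwidenZ; have [->|mi0] := eqVneq (m i) 0%N.
  by rewrite mul0r scale0r rpred0.
apply/rpredZ/wX; have le_im : (U_(i) <= m)%MM.
  by apply/mnm_lepP => j; rewrite mnm1E; case: eqP => // <-; rewrite lt0n.
have := congr1 mdeg (submK le_im); rewrite mdegD mdeg1 dm addn1.
by case.
Qed.

Definition eigen_gen f i : quadric K := DHomog (eigen_gen_homog f i).

Definition eigen_plane f : {vspace quadric K} :=
  <<[tuple eigen_gen f i | i < 4]>>%VS.

Lemma dim_eigen_plane f : \dim (eigen_plane f) == 4%N.
Proof.
suff: free [tuple eigen_gen f i | i < 4] by rewrite /free size_tuple.
apply/freeP => k; under eq_bigr do rewrite -tnth_nth tnth_mktuple.
move=> k0 i.
pose m : 'X_{1..5} := (U_(ord_max) + mnmwiden U_(i))%MM.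
have m_max : m ord_max = 1%N.
  by rewrite /m mnmDE mnm1E eqxx mnmwiden_ordmax.
have wm0 (p : {mpoly K[4]}) : (mwiden p)@_m = 0.
  rewrite (mwidenE (leqnn _)) raddf_sum /= big1 // => m' _.
  rewrite mcoeffZ mcoeffX; case: eqP => [E|]; last by rewrite mulr0.
  by move: m_max; rewrite -E mnmwiden_ordmax.
have := congr1 (fun q : quadric K => (mpoly_of_dhomog q)@_m) k0.
rewrite raddf_sum /= raddf_sum /= mcoeff0 (bigD1 i) //= big1 ?addr0 => [|j ji].
  rewrite mcoeffZ mcoeffB wm0 mwidenX -mpolyXD mcoeffX.
  by rewrite eqxx sub0r mulrN1 => /eqP; rewrite oppr_eq0 => /eqP.
rewrite mcoeffZ mcoeffB wm0 mwidenX -mpolyXD mcoeffX.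
rewrite /m eqm_add2l (inj_eq (@inj_mnmwiden _)).
case: eqP => [/mnmP /(_ j)|_]; last by rewrite subr0 mulr0.
by rewrite !mnm1E eqxx eq_sym (negbTE ji).
Qed.

Definition eigen_point f : Gr K := exist _ (eigen_plane f) (dim_eigen_plane f).

End EigenPlane.

Definition eigen_locus (K : fieldType) : set (Gr K) := range (@eigen_point K).
Arguments eigen_locus : clear implicits.

(* Main.v *)
(** The 3-plane of [f] is the graph, over the span of the [lambda * x_i], of a
   map into the remaining quadrics, so its Plücker coordinate at
   [lambda * x_0, ..., lambda * x_3] is nonzero. On the chart where this
   coordinate does not vanish, the entries of the graph are, up to that
   coordinate, Plücker coordinates by Cramer's rule. The graph comes from a
   cubic if and only if it has no [lambda^2] term and the quadrics [q_i]
   satisfy [d q_i / d x_j = d q_j / d x_i]; these conditions are linear in the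
   Plücker coordinates, and by Euler's formula they suffice, with
   [f = (x_0 q_0 + ... + x_3 q_3) / 3]. *)

Require Import Defs.
From mathcomp Require Import all_boot all_order all_algebra.
From mathcomp Require Import perm mpoly complex.
From mathcomp Require Import boolp classical_sets reals.

Set Implicit Arguments.
Unset Strict Implicit.
Unset Printing Implicit Defensive.

Import GRing.Theory Num.Theory.
Local Open Scope ring_scope.

(** Laplace expansion along column [i]: the cofactors of that column do not see its entries, so
    replacing it by [v] leaves them unchanged. *)
Lemma sum_adj_det (R : comPzRingType) n (A : 'M[R]_n) (v : 'I_n -> R) i :
  \sum_k (\adj A) i k * v k =
  \det (\matrix_(k, j) if j == i then v k else A k j).
Proof.
rewrite (expand_det_col _ i); apply: eq_bigr => k _.
rewrite !mxE eqxx mulrC; congr (_ * _).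
rewrite /cofactor; congr (_ * \det _); apply/matrixP => a b.
by rewrite !mxE eq_sym (negbTE (neq_lift _ _)).
Qed.

(** * Linear forms in the Plücker coordinates *)

Section LinearPluckerFunctions.
Variable K : fieldType.

Definition pl_linear (h : Gr K -> K) : Prop :=
  exists2 F : pl_poly K, F \is 1.-homog for mdeg & forall W, pl_eval F W = h W.

Lemma pl_linear_ext h1 h2 : h1 =1 h2 -> pl_linear h1 -> pl_linear h2.
Proof. by move=> eqh [F hF evF]; exists F => // W; rewrite evF. Qed.

Lemma pl_linearZ c h : pl_linear h -> pl_linear (fun W => c * h W).
Proof.
case=> F hF evF; exists (c *: F); first exact: rpredZ.
by move=> W; rewrite -evF /pl_eval mevalZ.
Qed.

Lemma pl_linearB h1 h2 :
  pl_linear h1 -> pl_linear h2 -> pl_linear (fun W => h1 W - h2 W).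
Proof.
case=> F hF evF [G hG evG]; exists (F - G); first exact: rpredB.
by move=> W; rewrite -evF -evG /pl_eval mevalB.
Qed.

(** Taken in the same basis as [pl_coord], so that comparison with Plücker coordinates is an exact
    equality. The columns may come in any order and may repeat, as happens in Cramer's rule. *)
Definition minor (W : Gr K) (t : 'I_4 -> 'X_{1..5}) : K :=
  \det (\matrix_(i < 4, j < 4) (mpoly_of_dhomog (vbasis (val W))`_i)@_(t j)).

(** A repeated monomial gives two equal columns and the zero form; otherwise the minor is, up to the
    sign of a reordering, a single Plücker coordinate. *)
Lemma pl_linear_minor t :
  (forall j, mdeg (t j) = 2%N) -> pl_linear (fun W => minor W t).
Proof.
move=> dt; have dt3 j : (mdeg (t j) < 3)%N by rewrite dt.
pose u j : qmon := exist _ (BMultinom (dt3 j)) (introT eqP (dt j)).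
have ut j : bmnm (val (u j)) = t j by [].
have [inj_u|] := boolP (injectiveb u); last first.
  case/injectivePn=> j1 [j2 j12 eq_u]; exists 0; first exact: rpred0.
  move=> W; rewrite /pl_eval meval0 /minor -det_tr.
  rewrite (determinant_alternate j12) // => k.
  by rewrite !mxE -!ut eq_u.
move/injectiveP in inj_u.
have cardI : #|[set u j | j : 'I_4]| == 4%N.
  by rewrite card_imset // card_ord.
pose I : pl_index := exist _ [set u j | j : 'I_4] cardI.
pose e (j : 'I_4) : qmon := enum_val (cast_ord (esym (eqP (valP I))) j).
have inj_e : injective e by move=> j1 j2 /enum_val_inj /cast_ord_inj.
have ue j : {k | u j = e k}.
  have uI : u j \in val I by rewrite /= imset_f.
  exists (cast_ord (eqP (valP I)) (enum_rank_in uI (u j))).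
  by rewrite /e cast_ordK enum_rankK_in.
(* [s] is the permutation relating the order of the [t j] to the order in which [pl_mon] enumerates
   [I]. *)
pose s j := sval (ue j).
have se j : u j = e (s j) by rewrite /s; case: (ue j).
have inj_s : injective s by move=> j1 j2 eqs; apply: inj_u; rewrite !se eqs.
pose sg : K := (-1) ^+ perm inj_s.
exists (sg *: 'X_(enum_rank I)).
  by apply: rpredZ; rewrite dhomogX /= mdeg1.
move=> W; rewrite /pl_eval mevalZ mevalXU enum_rankK /pl_coord /pl_minor.
rewrite /sg -[X in _ * X]det_tr -det_perm -det_mulmx /minor -[RHS]det_tr.
rewrite -row_permE.
congr (\det _); apply/matrixP => j i; rewrite !mxE permE.
by rewrite /pl_mon -/(e (s j)) -se ut.
Qed.

Lemma linear_section_zeros (I : finType) (h : I -> Gr K -> K) :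
  (forall i, pl_linear (h i)) ->
  linear_section [set W | forall i, h i W = 0]%classic.
Proof.
move=> lin_h.
have [F hF] : {F : I -> pl_poly K & forall i,
    F i \is 1.-homog for mdeg /\ forall W, pl_eval (F i) W = h i W}.
  apply: (@choice _ _ (fun i F => F \is 1.-homog for mdeg /\
                                  forall W, pl_eval F W = h i W)) => i.
  by have [F ? ?] := lin_h i; exists F.
exists [seq F i | i <- enum I].
  by move=> _ /mapP [i _ ->]; case: (hF i).
apply/seteqP; split=> W /= zW.
  by move=> _ /mapP [i _ ->]; case: (hF i) => _ ->.
by move=> i; case: (hF i) => _ <-; apply: zW; rewrite map_f ?mem_enum.
Qed.

End LinearPluckerFunctions.

(** * Quadrics sorted by their degree in lambda, and the coefficients of the generators *)

Section EigenGenerators.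
Variable K : fieldType.
Implicit Types (f : dhomog 4 K 3) (i j k : 'I_4) (g : quadric K) (W : Gr K).

Definition lambda2 : 'X_{1..5} := (U_(ord_max) *+ 2)%MM.
Definition lambdax i : 'X_{1..5} := (U_(ord_max) + mnmwiden U_(i))%MM.

Lemma mdeg_mnmwiden n (m : 'X_{1..n}) : mdeg (mnmwiden m) = mdeg m.
Proof.
rewrite !mdegE big_ord_recr /= mnmwiden_ordmax addn0.
by apply: eq_bigr => i _; rewrite mnmwiden_widen.
Qed.

Lemma mdeg_lambdax i : mdeg (lambdax i) = 2%N.
Proof. by rewrite mdegD mdeg1 mdeg_mnmwiden mdeg1. Qed.

Lemma mdeg_lambda2 : mdeg lambda2 = 2%N.
Proof. by rewrite mdegMn mdeg1. Qed.

Lemma mnm_lastE n (m : 'X_{1..n.+1}) :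
  {m' : 'X_{1..n} | m = (U_(ord_max) *+ m ord_max + mnmwiden m')%MM}.
Proof.
exists [multinom m (widen_ord (leqnSn n) i) | i < n].
apply/mnmP => i; rewrite mnmDE mulmnE mnm1E.
have [->|ni] := eqVneq i ord_max.
  by rewrite mul1n mnmwiden_ordmax addn0.
have lt_i : (i < n)%N by rewrite ltn_neqAle -ltnS ltn_ord andbT.
have -> : i = widen_ord (leqnSn n) (Ordinal lt_i) by apply: val_inj.
by rewrite mnmwiden_widen mnmE mul0n add0n.
Qed.

Lemma quadric_eqP g1 g2 :
  (forall m : 'X_{1..4}, mdeg m = 2%N ->
     (val g1)@_(mnmwiden m) = (val g2)@_(mnmwiden m)) ->
  (forall i, (val g1)@_(lambdax i) = (val g2)@_(lambdax i)) ->
  (val g1)@_lambda2 = (val g2)@_lambda2 -> g1 = g2.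
Proof.
move=> eq0 eq1 eq2; apply/val_inj/mpolyP => m.
have [dm|dm] := eqVneq (mdeg m) 2; last first.
  by rewrite !(@dhomog_nemf_coeff _ _ mdeg 2) ?(valP g1) ?(valP g2).
have [m' mE] := mnm_lastE m; move: mE dm.
(* The cases are the exponents 0, 1, 2 of lambda; a larger one contradicts degree 2. *)
case: (m ord_max) => [|[|[|k]]] -> .
- by rewrite mulm0n add0m mdeg_mnmwiden; apply: eq0.
- rewrite mdegD mdegMn mdeg1 mdeg_mnmwiden mulm1n add1n => -[/eqP].
  by move=> /mdeg1P [i /eqP ->]; apply: eq1.
- rewrite mdegD mdegMn mdeg1 mdeg_mnmwiden => -[/eqP].
  by rewrite mdeg_eq0 => /eqP ->; rewrite mnmwiden0 addm0.
- by rewrite mdegD mdegMn mdeg1.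
Qed.

Lemma mcoeff_mwiden_max n (p : {mpoly K[n]}) (m : 'X_{1..n.+1}) :
  m ord_max != 0%N -> (mwiden p)@_m = 0.
Proof.
move=> m_max; rewrite (mwidenE (leqnn _)) raddf_sum /= big1 // => m' _.
rewrite mcoeffZ mcoeffX; case: eqP => [E|]; last by rewrite mulr0.
by move: m_max; rewrite -E mnmwiden_ordmax.
Qed.

Lemma eigen_gen_widen f i (m : 'X_{1..4}) :
  (val (eigen_gen f i))@_(mnmwiden m) = ((val f)^`M(i))@_m.
Proof.
rewrite /= mcoeffB mwiden_mnmwiden mwidenX -mpolyXD mcoeffX.
case: eqP => [/mnmP /(_ ord_max)|]; last by rewrite subr0.
by rewrite mnmDE mnm1E eqxx !mnmwiden_ordmax.
Qed.

Lemma eigen_gen_lambdax f i j :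
  (val (eigen_gen f i))@_(lambdax j) = - (i == j)%:R.
Proof.
rewrite /= mcoeffB mcoeff_mwiden_max; last by rewrite mnmDE mnm1E eqxx.
rewrite mwidenX -mpolyXD mcoeffX sub0r eqm_add2l (inj_eq (@inj_mnmwiden _)).
congr (- (nat_of_bool _)%:R); apply/eqP/eqP => [/mnmP /(_ i)|-> //].
by rewrite !mnm1E eqxx; case: eqP.
Qed.

Lemma eigen_gen_lambda2 f i : (val (eigen_gen f i))@_lambda2 = 0.
Proof.
rewrite /= mcoeffB mcoeff_mwiden_max; last by rewrite mulmnE mnm1E eqxx.
rewrite mwidenX -mpolyXD mcoeffX sub0r.
case: eqP => [/mnmP /(_ ord_max)|]; last by rewrite oppr0.
by rewrite mnmDE mulmnE mnm1E eqxx !mnmwiden_ordmax.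
Qed.

(** * Euler's formula and the integration of curl-free quadrics *)

Lemma mderiv_sum_homog n d (p : {mpoly K[n]}) : p \is d.-homog for mdeg ->
  \sum_(i < n) 'X_i * p^`M(i) = d%:R *: p.
Proof.
move=> hp; transitivity (\sum_(m <- msupp p) p@_m *: (d%:R *: 'X_[m])
    : {mpoly K[n]}); last first.
  rewrite [in RHS](mpolyE p) scaler_sumr; apply: eq_bigr => m _.
  by rewrite !scalerA mulrC.
under eq_bigr do rewrite {1}[p]mpolyE raddf_sum /= mulr_sumr.
rewrite exchange_big /=; apply: eq_big_seq => m mp.
under eq_bigr do rewrite mderivZ mderivX -!scalerAr.
rewrite -scaler_sumr -(dhomog_mf hp mp : mdeg m = d) mdegE natr_sum scaler_suml.
congr (_ *: _); apply: eq_bigr => i _.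
(* For [m i = 0] the truncated subtraction [m - U_(i)] is not undone by adding [U_(i)], but the
   scalar vanishes. *)
have [->|mi] := eqVneq (m i) 0%N; first by rewrite !scale0r.
rewrite -mpolyXD addmC submK //; apply/mnm_lepP => j.
by rewrite mnm1E; case: eqP => // <-; rewrite lt0n.
Qed.

(* The coefficient of x_k in d q_i / d x_j - d q_j / d x_i. *)
Definition curl (q : 'I_4 -> quadric K) i j k : K :=
  (U_(k)%MM j).+1%:R * (val (q i))@_(mnmwiden (U_(k) + U_(j))) -
  (U_(k)%MM i).+1%:R * (val (q j))@_(mnmwiden (U_(k) + U_(i))).

Lemma curl_eigen_gen f i j k : curl (eigen_gen f) i j k = 0.
Proof.
by rewrite /curl !eigen_gen_widen !mulr_natl -!mcoeff_deriv mderiv_comm subrr.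
Qed.

Lemma curl_free_eigen_gen (q : 'I_4 -> quadric K) : 3%:R != 0 :> K ->
    (forall i j, (val (q i))@_(lambdax j) = - (i == j)%:R) ->
    (forall i, (val (q i))@_lambda2 = 0) ->
    (forall i j k, curl q i j k = 0) ->
  exists f, forall i, q i = eigen_gen f i.
Proof.
move=> K3 qLx qLL q_curl.
(* [p i] is the part of [q i] free of lambda, as a polynomial in the [x_j] alone. *)
pose p i : {mpoly K[4]} :=
  \sum_(m : 'X_{1..4 < 3} | mdeg m == 2%N) (val (q i))@_(mnmwiden m) *: 'X_[m].
have hp i : p i \is 2.-homog for mdeg.
  by apply: rpred_sum => m dm; apply: rpredZ; rewrite dhomogX.
have pE i (m : 'X_{1..4}) :
    mdeg m = 2%N -> (p i)@_m = (val (q i))@_(mnmwiden m).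
  move=> dm; have dm3 : (mdeg m < 3)%N by rewrite dm.
  rewrite /p raddf_sum /= (bigD1 (BMultinom dm3)) /= ?dm //.
  rewrite mcoeffZ mcoeffX eqxx mulr1 big1 ?addr0 // => m' /andP [_ ne].
  rewrite mcoeffZ mcoeffX; case: eqP => [E|]; last by rewrite mulr0.
  by case/eqP: ne; apply: val_inj.
have p_curl i j : (p i)^`M(j) = (p j)^`M(i).
  apply/mpolyP => m; rewrite !mcoeff_deriv.
  have [/mdeg1P [k /eqP ->]|dm] := boolP (mdeg m == 1%N).
    rewrite !pE ?mdegD ?mdeg1 //; have := q_curl i j k.
    by rewrite /curl !mulr_natl => /subr0_eq.
  (* If [m] does not have degree 1, both sides are coefficients of quadratic forms in a degree other
     than 2. *)
  rewrite !(@dhomog_nemf_coeff _ _ mdeg 2) ?hp ?mul0rn //=;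
  by rewrite mdegD mdeg1 addn1 eqSS.
pose F : {mpoly K[4]} := 3%:R^-1 *: \sum_i 'X_i * p i.
have hF : F \is 3.-homog for mdeg.
  apply/rpredZ/rpred_sum => i _; rewrite -[3%N]/(1 + 2)%N.
  by apply: dhomogM => //; rewrite dhomogX /= mdeg1.
have dF j : F^`M(j) = p j.
  rewrite /F mderivZ (raddf_sum (mderiv j)) /=.
  (* By the product rule and symmetry, three times the derivative is [p j] plus the Euler sum of
     [p j], that is [p j + 2 p j]. *)
  under eq_bigr do rewrite mderivM p_curl.
  rewrite big_split /= (mderiv_sum_homog (hp j)) (bigD1 j) //= big1 => [|i ij].
    rewrite addr0 mderivX mnm1E eqxx scale1r.
    rewrite -{1}[U_(j)%MM]add0m addmK mpolyX0 mul1r.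
    by rewrite -{1}[p j]scale1r -scalerDl scalerA -(natrD _ 1 2) mulVf ?scale1r.
  by rewrite mderivX mnm1E (negbTE ij) scale0r mul0r.
exists (DHomog hF) => i; apply: quadric_eqP => [m dm|j|].
- by rewrite eigen_gen_widen dF pE.
- by rewrite eigen_gen_lambdax qLx.
- by rewrite eigen_gen_lambda2 qLL.
Qed.

(** * Cramer generators on the chart *)

Definition chart_mx W : 'M[K]_4 :=
  \matrix_(k, j) (val (vbasis (val W))`_k)@_(lambdax j).

(** The graph basis multiplied by the determinant of the chart. Without the division it is defined
    for every [W], and its coefficients are minors, hence linear in the Plücker coordinates. *)
Definition cramer W i : quadric K :=
  \sum_k (\adj (chart_mx W)) i k *: (vbasis (val W))`_k.

Lemma mcoeff_cramer W i m : (val (cramer W i))@_m =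
  minor W (fun j => if j == i then m else lambdax j).
Proof.
rewrite /cramer raddf_sum raddf_sum /=.
under eq_bigr do rewrite mcoeffZ.
rewrite sum_adj_det; congr (\det _); apply/matrixP => k j.
by rewrite !mxE; case: ifP.
Qed.

Lemma pl_linear_cramer i m :
  mdeg m = 2%N -> pl_linear (fun W => (val (cramer W i))@_m).
Proof.
move=> dm.
apply: pl_linear_ext (fun W => esym (mcoeff_cramer W i m)) _.
by apply: pl_linear_minor => j; case: ifP => // _; apply: mdeg_lambdax.
Qed.

Lemma pl_linear_det_chart : pl_linear (fun W => \det (chart_mx W)).
Proof. by apply: (@pl_linear_minor K lambdax); apply: mdeg_lambdax. Qed.

Lemma cramer_lambdax W i j :
  (val (cramer W i))@_(lambdax j) = \det (chart_mx W) *+ (i == j).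
Proof.
rewrite /cramer raddf_sum raddf_sum /=.
have := congr1 (fun A : 'M[K]_4 => A i j) (mul_adj_mx (chart_mx W)).
by rewrite !mxE => <-; apply: eq_bigr => k _; rewrite mcoeffZ !mxE.
Qed.

Lemma cramer_in W i : cramer W i \in val W.
Proof.
apply: rpred_sum => k _; apply/rpredZ/vbasis_mem/mem_nth.
by rewrite size_tuple (eqP (valP W)).
Qed.

(** The matrix of [lambda * x_j] coefficients of the generators is minus the identity, so the
    coordinates of [g] can be read off. *)
Lemma eigen_plane_coord f g : g \in eigen_plane f ->
  g = \sum_j - (val g)@_(lambdax j) *: eigen_gen f j.
Proof.
pose c j := coord [tuple eigen_gen f i | i < 4] j g; move=> gf.
have gE : g = \sum_j c j *: eigen_gen f j.
  rewrite {1}(coord_span gf); apply: eq_bigr => j _.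
  by rewrite -tnth_nth tnth_mktuple.
rewrite [LHS]gE; apply: eq_bigr => j _; congr (_ *: _).
rewrite [in RHS]gE raddf_sum raddf_sum /= (bigD1 j) //= big1 => [|k kj];
  rewrite mcoeffZ eigen_gen_lambdax ?eqxx ?(negbTE kj) ?oppr0 ?mulr0 //.
by rewrite mulrN1 addr0 opprK.
Qed.

Lemma cramer_eigen_point f i :
  cramer (eigen_point f) i = - \det (chart_mx (eigen_point f)) *: eigen_gen f i.
Proof.
rewrite [LHS](@eigen_plane_coord f) ?(cramer_in (eigen_point f)) //.
rewrite (bigD1 i) //= big1 => [|j ji]; rewrite cramer_lambdax.
  by rewrite eqxx addr0.
by rewrite eq_sym (negbTE ji) oppr0 scale0r.
Qed.

(** A kernel vector would give an element of the plane with no [lambda * x_j] terms; such an element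
    is zero, against the freeness of the basis. *)
Lemma det_chart_eigen_point f : \det (chart_mx (eigen_point f)) != 0.
Proof.
set W := eigen_point f; apply/negP => /det0P [v v0 vA].
pose g := \sum_k v 0 k *: (vbasis (val W))`_k.
have gW : g \in eigen_plane f.
  apply: rpred_sum => k _; apply/rpredZ/(@vbasis_mem _ _ _ (val W))/mem_nth.
  by rewrite size_tuple (eqP (valP W)).
have g0 : g = 0.
  rewrite (eigen_plane_coord gW) big1 // => j _.
  have -> : (val g)@_(lambdax j) = (v *m chart_mx W) 0 j.
    rewrite /g raddf_sum raddf_sum mxE /=.
    by apply: eq_bigr => k _; rewrite mcoeffZ mxE.
  by rewrite vA mxE oppr0 scale0r.
case/eqP: v0; apply/rowP => k; rewrite mxE.
have := basis_free (vbasisP (val W)); move: g0; rewrite /g.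
(* The basis is generalised so that the dimension in its type can be replaced by 4. *)
move: (vbasis (val W)); rewrite (eqP (valP W)) => b g0 /freeP.
exact.
Qed.

(** * The linear equations and the open chart that cut out the locus *)

Definition eigen_equations W : Prop :=
  (forall i, (val (cramer W i))@_lambda2 = 0) /\
  (forall i j k, curl (cramer W) i j k = 0).

(** The equations are homogeneous in the generators, so they pass between the Cramer generators and
    their multiples normalised to those of a cubic. *)
Lemma eigen_locusP : 3%:R != 0 :> K -> forall W,
  range (@eigen_point K) W <-> eigen_equations W /\ \det (chart_mx W) != 0.
Proof.
move=> K3 W; split=> [[f _ <-]|[[eqLL eq_curl] d0]].
  split; last exact: det_chart_eigen_point.
  set W' := eigen_point f; have cE i m : (val (cramer W' i))@_m =
      - \det (chart_mx W') * (val (eigen_gen f i))@_m.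
    by rewrite cramer_eigen_point /= mcoeffZ.
  split=> [i|i j k]; first by rewrite cE eigen_gen_lambda2 mulr0.
  rewrite /curl !cE; set d := - _.
  rewrite !(mulrCA _ d) -mulrBr.
  by rewrite -/(curl (eigen_gen f) i j k) curl_eigen_gen mulr0.
set d := \det _ in d0.
(* The factor turns the [lambda * x_j] coefficients into minus the identity, as for the generators
   of a cubic. *)
pose q i := - d^-1 *: cramer W i.
have qE i m : (val (q i))@_m = - d^-1 * (val (cramer W i))@_m.
  by rewrite /q /= mcoeffZ.
have [|||f qf] := @curl_free_eigen_gen q K3.
- by move=> i j; rewrite qE cramer_lambdax mulrnAr mulNr mulVf ?mulNrn.
- by move=> i; rewrite qE eqLL mulr0.
- move=> i j k; rewrite /curl !qE !(mulrCA _ (- d^-1)) -mulrBr.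
  by rewrite -/(curl (cramer W) i j k) eq_curl mulr0.
(* Both planes have dimension 4, so one inclusion suffices. *)
exists f => //; apply/val_inj/eqP; rewrite eqEdim.
rewrite (eqP (valP W)) (eqP (valP (eigen_point f))) leqnn andbT.
apply/span_subvP => _ /tnthP [i ->]; rewrite tnth_mktuple -qf.
exact/rpredZ/cramer_in.
Qed.

Lemma linear_section_eigen_equations :
  linear_section [set W | eigen_equations W]%classic.
Proof.
pose h (x : 'I_4 + 'I_4 * 'I_4 * 'I_4) W :=
  match x with
  | inl i => (val (cramer W i))@_lambda2
  | inr (i, j, k) => curl (cramer W) i j k
  end.
have -> : [set W | eigen_equations W]%classic =
    [set W | forall x, h x W = 0]%classic.
  apply/seteqP; split=> [W [eqLL eq_curl] [i|[[i j] k]]|W hW].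
  - exact: eqLL.
  - exact: eq_curl.
  - by split=> [i|i j k]; [apply: (hW (inl i)) | apply: (hW (inr (i, j, k)))].
apply: linear_section_zeros => -[i|[[i j] k]].
  exact/pl_linear_cramer/mdeg_lambda2.
by apply: pl_linearB; apply/pl_linearZ/pl_linear_cramer;
  rewrite mdeg_mnmwiden mdegD !mdeg1.
Qed.

End EigenGenerators.

Theorem corollary5p2 (R : realType) :
  exists2 Z : set (Gr R[i]), linear_section Z
    & zariski_open_in Z (eigen_locus R[i]).
Proof.
exists [set W | eigen_equations W]%classic.
  exact: linear_section_eigen_equations.
have [D hD evD] := pl_linear_det_chart R[i].
(* The closed set removed is the hyperplane section where the determinant of the chart vanishes. *)
exists (pl_zeros [:: D]).
  by exists [:: D] => // F; rewrite inE => /eqP ->; exists 1%N.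
have K3 : 3%:R != 0 :> R[i] by rewrite pnatr_eq0.
apply/seteqP; split=> W.
  case/(eigen_locusP K3) => eqW d0; split=> // /(_ D (mem_head _ _)).
  by rewrite evD => /eqP; rewrite (negbTE d0).
case=> eqW nzD; apply/(eigen_locusP K3); split=> //.
apply/eqP => d0; apply: nzD => F; rewrite inE => /eqP ->.
by rewrite evD.
Qed.
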